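(* Let $p\ge2$ be an integer, and let $(c_l)_{l\in\{0,2,4,\dots\}}$ be the positive coefficients in the expansion $$v_p(n)=\sum_{l\in\{0,2,4,\dots\}}c_l\,n^{-l-p}\qquad(n\in\mathbb{N})$$ of the weight $$v_p(n)=\left(1-\left(1-\frac1n\right)^{\frac{p-1}{p}}\right)^{p-1}-\left(\left(1+\frac1n\right)^{\frac{p-1}{p}}-1\right)^{p-1}.$$ Then for every finitely supported $\psi:\mathbb{N}\to\mathbb{R}$, $$\sum_{l\in\{0,2,4,\dots\}}c_l\sum_{n=1}^{\infty}\ \sup_{m\in\mathbb{N}}\left|\min\left\{\frac{1}{n^{\frac{l+p}{p}}},\frac{1}{m^{\frac{l+p}{p}}}\right\}\sum_{k=1}^{m}\psi(k)\right|^p\ \le\ \sum_{n=1}^{\infty}|\psi(n)|^p .$$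
   Context: $\mathbb{N}=\{1,2,3,\dots\}$. A function $\psi$ on $\mathbb{N}$ is finitely supported if $\psi(n)=0$ for all but finitely many $n$. For an integer $p\ge2$ it is known (Fischer, Keller, Pogorzelski) that $v_p$ has the stated expansion with $c_l>0$ for every $l\in\{0,2,4,\dots\}$; the number $c_l$ is the coefficient of $x^{l+p}$ in the power series at $x=0$ of $\left(1-(1-x)^{\frac{p-1}{p}}\right)^{p-1}-\left((1+x)^{\frac{p-1}{p}}-1\right)^{p-1}$. *)

(* Defs.v *)
From HB Require Import structures.
From mathcomp Require Import all_boot all_order all_algebra.
From mathcomp Require Import all_classical all_reals all_analysis.

Set Implicit Arguments.
Unset Strict Implicit.
Unset Printing Implicit Defensive.

Import Order.TTheory GRing.Theory Num.Theory.
Import numFieldNormedType.Exports.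

Local Open Scope classical_set_scope.
Local Open Scope ring_scope.

(* The positive integers {1, 2, 3, ...} are represented by the naturals [n]
   with [0 < n]; functions on them are functions [nat -> R] whose value at [0]
   is never used. *)

Definition finitely_supported (R : realType) (psi : nat -> R) : Prop :=
  finite_set [set n : nat | (0 < n)%N /\ psi n != 0].

(* At [n = 1] the first base is [0], and [0 `^ a = 0] as [a != 0] for
   [1 < p]. *)
Definition hardy_weight (R : realType) (p n : nat) : R :=
  let a : R := (p%:R - 1) / p%:R in
  (1 - (1 - n%:R^-1) `^ a) ^+ p.-1 - ((1 + n%:R^-1) `^ a - 1) ^+ p.-1.

(* Only the values [c l] at even [l] matter. *)
Definition is_hardy_weight_expansion
    (R : realType) (p : nat) (c : nat -> R) : Prop :=
  forall n : nat, (0 < n)%N ->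
    (\sum_(0 <= l < N | ~~ odd l) c l * n%:R ^- (l + p)) @[N --> \oo]
      --> hardy_weight R p n.

Definition sup_term (R : realType) (p l : nat) (psi : nat -> R) (n : nat) :
    \bar R :=
  let b : R := (l + p)%:R / p%:R in
  ereal_sup [set (`| Num.min (1 / n%:R `^ b) (1 / m%:R `^ b)
                     * \sum_(1 <= k < m.+1) psi k | ^+ p)%:E
            | m in [set m : nat | (0 < m)%N]].

(* Main.v *)
(* Replacing |psi| by its nonincreasing rearrangement g keeps the right-hand
   side and can only increase the partial sums. For nonincreasing g the averages
   (g_1 + ... + g_m) / m decrease in m, so the n-th supremum is at most
   n^{-l-p} (g_1 + ... + g_n)^p. Summing over l first, the claim becomes Hardy's
   inequality with weight v_p for g, which holds because u(n) = n^{(p-1)/p} is a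
   supersolution: (u(n) - u(n-1))^{p-1} - (u(n+1) - u(n))^{p-1}
   = v_p(n) u(n)^{p-1}; a Picone-type inequality and summation by parts
   conclude. *)
Require Import Defs.
From HB Require Import structures.
From mathcomp Require Import all_boot all_order all_algebra.
From mathcomp Require Import all_classical all_reals all_analysis.
From mathcomp Require Import ring lra.

Set Implicit Arguments.
Unset Strict Implicit.
Unset Printing Implicit Defensive.

Import Order.TTheory GRing.Theory Num.Theory.
Import numFieldNormedType.Exports.

Local Open Scope classical_set_scope.
Local Open Scope ring_scope.

(** * Young's and Radon's inequalities for integer powers *)

(** The power [q.+1] lies above its tangent line at [s]. By induction on [q]: multiply by [s] and
    add [monoX], which expresses that powers increase. *)
Lemma young_exprn (R : realFieldType) (q : nat) (s t : R) :
  0 <= s -> 0 <= t -> q.+1%:R * s ^+ q * t <= t ^+ q.+1 + q%:R * s ^+ q.+1.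
Proof.
move=> s0 t0; elim: q => [|q IH]; first by rewrite expr0 !expr1 mul0r; lra.
have monoX : 0 <= (s ^+ q.+1 - t ^+ q.+1) * (s - t).
  have [st|/ltW ts] := leP s t.
    by rewrite mulr_le0 // subr_le0 // lerXn2r ?nnegrE.
  by rewrite mulr_ge0 // subr_ge0 // lerXn2r ?nnegrE.
have := ler_wpM2l s0 IH.
rewrite -(natr1 q.+1) -(natr1 q) !exprS in monoX *; lra.
Qed.

Lemma young_scaled (R : realFieldType) (q : nat) (s b x : R) :
  0 <= s -> 0 <= b -> 0 < x ->
  q.+1%:R * s ^+ q * b <= b ^+ q.+1 / x ^+ q + q%:R * x * s ^+ q.+1.
Proof.
move=> s0 b0 x0.
have := ler_wpM2l (ltW x0) (young_exprn q s0 (divr_ge0 b0 (ltW x0))).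
rewrite expr_div_n (exprS x) => h.
have -> : q.+1%:R * s ^+ q * b = x * (q.+1%:R * s ^+ q * (b / x)).
  by field; rewrite gt_eqF.
apply: (le_trans h); rewrite le_eqVlt; apply/orP; left; apply/eqP.
by field; rewrite ?expf_neq0 ?gt_eqF.
Qed.

(** The tangent-line bounds for the pairs [b, x] and [d, y] are taken at the common slope [s],
    chosen so that their sum reproduces the left-hand side. This serves as the Picone-type
    inequality. *)
Lemma radon_exprn (R : realFieldType) (q : nat) (b d x y : R) :
  0 <= b -> 0 <= d -> 0 < x -> 0 < y ->
  (b + d) ^+ q.+1 / (x + y) ^+ q <= b ^+ q.+1 / x ^+ q + d ^+ q.+1 / y ^+ q.
Proof.
move=> b0 d0 x0 y0; set s := (b + d) / (x + y).
have xy0 : 0 < x + y by rewrite addr_gt0.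
have s0 : 0 <= s by rewrite divr_ge0 ?addr_ge0 // ltW.
have := lerD (young_scaled q s0 b0 x0) (young_scaled q s0 d0 y0).
have E : s ^+ q.+1 * (x + y) = s ^+ q * (b + d).
  by rewrite exprSr -mulrA /s divfK // gt_eqF.
have -> : (b + d) ^+ q.+1 / (x + y) ^+ q = s ^+ q * (b + d).
  by rewrite /s expr_div_n exprSr; ring.
rewrite -(natr1 q); have := congr1 ( *%R q%:R) E; lra.
Qed.

(** * Hardy's inequality for the weight, by a supersolution *)

Lemma powR_natB (R : realType) (a : R) (n : nat) : a != 0 ->
  n.+1%:R `^ a * (1 - n.+1%:R^-1) `^ a = n%:R `^ a.
Proof.
move=> a0; rewrite -powRM ?subr_ge0 ?invf_le1 ?ler1n ?ltr0n //.
by rewrite mulrBr mulr1 divff // -natr1 addrK.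
Qed.

Lemma powR_natD (R : realType) (a : R) (n : nat) :
  n.+1%:R `^ a * (1 + n.+1%:R^-1) `^ a = n.+2%:R `^ a.
Proof.
rewrite -powRM ?addr_ge0 ?invr_ge0 //.
by rewrite mulrDr mulr1 divff // natr1.
Qed.

(** The factor [u n.+1] moves inside both [q]-th powers of the weight, where it produces the
    neighbouring values [u n] and [u n.+2]. *)
Lemma hardy_weight_supersol (R : realType) (q n : nat)
    (a := (q.+1%:R - 1) / q.+1%:R : R) (u := fun k : nat => k%:R `^ a) :
  (0 < q)%N ->
  hardy_weight R q.+1 n.+1 * u n.+1 ^+ q =
    (u n.+1 - u n) ^+ q - (u n.+2 - u n.+1) ^+ q.
Proof.
move=> q0; have a0 : a != 0.
  by rewrite /a -natr1 addrK natr1 mulf_neq0 ?invr_eq0 ?pnatr_eq0 -?lt0n.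
rewrite /u -(powR_natB n a0) -(powR_natD a n) /hardy_weight -/a /=.
set z := _ `^ a; rewrite mulrBl -!exprMn; congr (_ ^+ _ - _ ^+ _); ring.
Qed.

Lemma ltr_powR_nat (R : realType) (a : R) (m n : nat) :
  0 < a -> (m < n)%N -> m%:R `^ a < n%:R `^ a.
Proof. by move=> a0 mn; rewrite gt0_ltr_powR ?nnegrE ?ler0n ?ltr_nat. Qed.

(** Indices are shifted: [g k] belongs to the integer [k.+1]. The supersolution identity is summed
    by parts against [w], by induction on [M], and Radon's inequality gives the inductive step. *)
Lemma hardy_partial (R : realType) (q : nat) (g : nat -> R) (M : nat) :
  (0 < q)%N -> (forall k, 0 <= g k) ->
  \sum_(0 <= n < M) hardy_weight R q.+1 n.+1 * (\sum_(0 <= k < n.+1) g k) ^+ q.+1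
    <= \sum_(0 <= n < M) g n ^+ q.+1.
Proof.
move=> q0 g0.
set a : R := (q.+1%:R - 1) / q.+1%:R.
have a0 : 0 < a by rewrite /a -natr1 addrK natr1 divr_gt0 ?ltr0n.
pose u (k : nat) : R := k%:R `^ a.
pose phi n := \sum_(0 <= k < n) g k.
have phi0 n : 0 <= phi n by apply: sumr_ge0.
have u_lt m n : (m < n)%N -> u m < u n by exact: ltr_powR_nat.
have u0 : u 0 = 0 by rewrite /u powR0 // gt_eqF.
pose w n := phi n ^+ q.+1 / u n ^+ q.
(* The extra term is the boundary term of the summation by parts. *)
suff h : \sum_(0 <= n < M) hardy_weight R q.+1 n.+1 * phi n.+1 ^+ q.+1
      + w M * (u M.+1 - u M) ^+ q <= \sum_(0 <= n < M) g n ^+ q.+1.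
  apply: le_trans h; rewrite lerDl mulr_ge0 ?divr_ge0 ?exprn_ge0 //.
  - by rewrite powR_ge0.
  - by rewrite subr_ge0 ltW ?u_lt.
elim: M => [|M IH].
  by rewrite !big_geq // /w /phi big_geq // expr0n /= !mul0r addr0.
rewrite !big_nat_recr //=.
have uS : 0 < u M.+1 by rewrite -u0 u_lt.
have -> : hardy_weight R q.+1 M.+1 * phi M.+1 ^+ q.+1
    = w M.+1 * ((u M.+1 - u M) ^+ q - (u M.+2 - u M.+1) ^+ q).
  rewrite -hardy_weight_supersol // /w -/a -/(u M.+1).
  by field; rewrite ?expf_neq0 ?gt_eqF.
(* The powers of [u M.+2 - u M.+1] from the weight and from the new boundary term cancel. *)
suff : w M.+1 * (u M.+1 - u M) ^+ q <= w M * (u M.+1 - u M) ^+ q + g M ^+ q.+1.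
  by move: IH; lra.
have d0 : 0 < u M.+1 - u M by rewrite subr_gt0 u_lt.
have dq0 : 0 < (u M.+1 - u M) ^+ q by rewrite exprn_gt0.
have phiS : phi M.+1 = phi M + g M by rewrite /phi big_nat_recr.
have gE : g M ^+ q.+1 = g M ^+ q.+1 / (u M.+1 - u M) ^+ q * (u M.+1 - u M) ^+ q.
  by rewrite divfK // gt_eqF.
(* At [M = 0] the denominator [u 0] vanishes, but so does [phi 0]. Otherwise Radon's inequality
   applies, its two denominators adding up to [u M.+2]. *)
rewrite gE -mulrDl ler_pM2r // /w phiS; case: M {IH} => [|M] in d0 dq0 phiS gE uS *.
  by rewrite /phi big_geq // u0 subr0 add0r lerDr divr_ge0 ?exprn_ge0.
have := @radon_exprn _ q _ _ (u M.+1) _ (phi0 M.+1) (g0 M.+1) _ d0.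
by rewrite [u M.+1 + _]addrC subrK; apply; rewrite -u0 u_lt.
Qed.

(** * Nonincreasing rearrangement *)

(** The first [N] values are sorted and extended by zeros. Equal sums for every [F] encode that [g]
    permutes [f]; the cases needed are [p]-th powers and positive parts. *)
Lemma nonincreasing_rearrangement (R : realDomainType) (f : nat -> R) (N : nat) :
    (forall k, 0 <= f k) -> (forall k, (N <= k)%N -> f k = 0) ->
  exists g : nat -> R, [/\ forall k, 0 <= g k,
    {homo g : i j / (i <= j)%N >-> j <= i} &
    forall (F : R -> R) M, (N <= M)%N ->
      \sum_(0 <= k < M) F (g k) = \sum_(0 <= k < M) F (f k)].
Proof.
move=> f0 fN; pose t := [seq f k | k <- index_iota 0 N].
pose s := sort >=%R t; exists (nth 0 s).
have sz : size s = N by rewrite size_sort size_map size_iota subn0.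
have s0 k : 0 <= nth 0 s k.
  have [kN|Nk] := ltnP k N; last by rewrite nth_default ?sz.
  have : nth 0 s k \in t by rewrite -(mem_sort >=%R) mem_nth // sz.
  by case/mapP => i _ ->.
split => //.
- move=> i j ij; have [jN|Nj] := ltnP j N; last by rewrite (@nth_default _ _ _ j) ?sz.
  apply: (sorted_leq_nth (rev_trans le_trans) _ 0 _) => //.
  + by apply: sort_sorted => x y; exact: le_total.
  + by rewrite inE sz (leq_ltn_trans ij).
  + by rewrite inE sz.
- move=> F M NM; rewrite (big_cat_nat (leq0n _) NM) //= [RHS](big_cat_nat (leq0n _) NM) //=; congr (_ + _).
    rewrite -[X in \sum_(0 <= k < X) F (nth _ _ _)]sz -(big_nth 0 xpredT).
    by rewrite (perm_big t) ?perm_sort // big_map.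
  by apply: eq_big_nat => k /andP[Nk _]; rewrite fN // nth_default ?sz.
Qed.

(* With the threshold [x = g m], both partial sums of [f - x] and [g - x] are
   compared with the rearrangement-invariant sum of the positive parts. *)
Lemma ler_sum_rearrangement (R : realDomainType) (f g : nat -> R) (N m : nat) :
    {homo g : i j / (i <= j)%N >-> j <= i} ->
    (forall (F : R -> R) M, (N <= M)%N ->
      \sum_(0 <= k < M) F (g k) = \sum_(0 <= k < M) F (f k)) ->
  \sum_(0 <= k < m) f k <= \sum_(0 <= k < m) g k.
Proof.
move=> g_dec fg; pose F y : R := Num.max (y - g m) 0.
pose K := maxn m N.
have mK : (m <= K)%N by rewrite leq_maxl.
have F0 y : 0 <= F y by rewrite le_max lexx orbT.
have : \sum_(0 <= k < m) (f k - g m) <= \sum_(0 <= k < m) (g k - g m).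
  apply: (@le_trans _ _ (\sum_(0 <= k < K) F (f k))).
    rewrite (big_cat_nat (leq0n _) mK) //= -[leLHS]addr0 lerD ?sumr_ge0 //.
    by apply: ler_sum => k _; rewrite le_max lexx.
  rewrite -fg ?leq_maxr // (big_cat_nat (leq0n _) mK) //= -[leRHS]addr0 lerD //.
    apply: ler_sum_nat => k /andP[_ km].
    by rewrite /F max_l ?subr_ge0 // g_dec // ltnW.
  rewrite big_nat big1 // => k /andP[mk _].
  by rewrite /F max_r // subr_le0 g_dec.
by rewrite !sumrB lerD2r.
Qed.

(** The value [g n] separates the two blocks: terms before index [n] are at least [g n], later ones
    at most [g n]. *)
Lemma ler_avg_nonincreasing (R : realFieldType) (g : nat -> R) (m n : nat) :
    {homo g : i j / (i <= j)%N >-> j <= i} -> (0 < n <= m)%N ->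
  (\sum_(0 <= k < m) g k) / m%:R <= (\sum_(0 <= k < n) g k) / n%:R.
Proof.
move=> g_dec /andP[n0 nm]; have m0 := leq_trans n0 nm.
rewrite ler_pdivrMr ?ltr0n // mulrAC ler_pdivlMr ?ltr0n //.
rewrite (big_cat_nat (leq0n _) nm) //= -(subnKC nm) natrD mulrDl mulrDr lerD2l.
apply: (@le_trans _ _ (g n * (m - n)%:R * n%:R)).
  rewrite ler_wpM2r // mulr_natr (subnKC nm) -sumr_const_nat.
  by apply: ler_sum_nat => k /andP[nk _]; exact: g_dec.
rewrite mulrAC ler_wpM2r // mulr_natr -{2}(subn0 n) -sumr_const_nat.
by apply: ler_sum_nat => k /andP[_ kn]; exact/g_dec/ltnW.
Qed.

Lemma finitely_supported_bound (R : realType) (psi : nat -> R) :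
  finitely_supported psi -> exists N, forall k, (N <= k)%N -> psi k.+1 = 0.
Proof.
move=> /finite_seqP[s sE]; exists (\max_(x <- s) x)%N => k sk.
apply/eqP; apply: contraTT sk => psik; rewrite -ltnNge.
have : [set` s] k.+1 by rewrite -sE.
by move=> /= ks; exact: (@leq_bigmax_seq _ _ xpredT id).
Qed.

(** * Bounds for the suprema and for the truncated expansion *)

Lemma sup_term_ge0 (R : realType) (p l : nat) (psi : nat -> R) (n : nat) :
  (0 <= sup_term p l psi n)%E.
Proof.
apply: le_trans (ereal_sup_ubound _); last by exists 1.
by rewrite lee_fin exprn_ge0.
Qed.

(* For [g] nonincreasing the averages [(\sum_(k < m) g k) / m] decrease in [m],
   so among the indices [m >= n] the bound is worst at [m = n]. *)
Lemma sup_term_le (R : realType) (p l n : nat) (psi g : nat -> R) :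
    (0 < p)%N -> (0 < n)%N -> (forall k, 0 <= g k) ->
    {homo g : i j / (i <= j)%N >-> j <= i} ->
    (forall m, \sum_(0 <= k < m) `|psi k.+1| <= \sum_(0 <= k < m) g k) ->
  (sup_term p l psi n
    <= (n%:R ^- (l + p) * (\sum_(0 <= k < n) g k) ^+ p)%:E)%E.
Proof.
move=> p0 n0 g0 g_dec psi_le; apply: ge_ereal_sup => _ [m /= m0 <-].
set b := (l + p)%:R / p%:R; rewrite lee_fin.
pose Phi j := \sum_(0 <= k < j) g k; rewrite -/(Phi n).
have Phi0 j : 0 <= Phi j by apply: sumr_ge0.
have psim : `|\sum_(1 <= k < m.+1) psi k| <= Phi m.
  rewrite big_add1 /=; apply: le_trans (psi_le m); exact: ler_norm_sum.
have powE j : (1 / j%:R `^ b) ^+ p = j%:R ^- (l + p) :> R.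
  rewrite div1r exprVn -powR_mulrn ?powR_ge0 // -powRrM /b divfK ?powR_mulrn //.
  by rewrite pnatr_eq0 -lt0n.
have min_ge0 : 0 <= Num.min (1 / n%:R `^ b) (1 / m%:R `^ b).
  by rewrite le_min !divr_ge0 ?powR_ge0.
rewrite normrM exprMn ger0_norm //.
(* For [m <= n] the minimum is bounded by its first entry and [Phi m] by [Phi n]; for [m > n] the
   second entry is used. *)
have [mn|nm] := leqP m n.
  rewrite -powE; apply: ler_pM; rewrite ?exprn_ge0 //.
    by rewrite lerXn2r ?nnegrE ?divr_ge0 ?powR_ge0 // ge_min lexx.
  rewrite lerXn2r ?nnegrE // (le_trans psim) // /Phi.
  by rewrite (big_cat_nat (leq0n _) mn) //= lerDl sumr_ge0.
apply: (@le_trans _ _ (m%:R ^- (l + p) * Phi m ^+ p)).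
  rewrite -powE; apply: ler_pM; rewrite ?exprn_ge0 //.
    by rewrite lerXn2r ?nnegrE ?divr_ge0 ?powR_ge0 // ge_min lexx orbT.
  by rewrite lerXn2r ?nnegrE.
(* The exponent [p] turns [Phi j] into an average, and the remaining [l] gives a factor that also
   decreases in [j]. *)
have splitE j : j%:R ^- (l + p) * Phi j ^+ p = j%:R ^- l * (Phi j / j%:R) ^+ p.
  by rewrite exprD invfM expr_div_n; ring.
rewrite !splitE; apply: ler_pM; rewrite ?exprn_ge0 ?invr_ge0 ?divr_ge0 //.
  by rewrite lef_pV2 ?posrE ?exprn_gt0 ?ltr0n // lerXn2r ?nnegrE // ler_nat ltnW.
rewrite lerXn2r ?nnegrE ?divr_ge0 //.
by apply: ler_avg_nonincreasing => //; rewrite n0 ltnW.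
Qed.

(** Nonnegative coefficients make the partial sums nondecreasing, hence bounded by their limit. *)
Lemma expansion_partial_le (R : realType) (p : nat) (c : nat -> R) (L n : nat) :
    (forall l, ~~ odd l -> 0 <= c l) -> is_hardy_weight_expansion p c ->
    (0 < n)%N ->
  \sum_(0 <= l < L | ~~ odd l) c l * n%:R ^- (l + p) <= hardy_weight R p n.
Proof.
move=> c0 hc n0; have cvg_c := hc n n0.
rewrite -(cvg_lim _ cvg_c) //; apply: nondecreasing_cvgn_le; last first.
  by apply/cvg_ex; exists (hardy_weight R p n).
move=> i j ij; rewrite (big_cat_nat (leq0n _) ij) //= lerDl sumr_ge0 // => l el.
by rewrite mulr_ge0 ?c0 // invr_ge0 exprn_ge0.
Qed.

Theorem theorem3p3 (R : realType) (p : nat) (hp : (2 <= p)%N)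
    (c : nat -> R)
    (hc_pos : forall l : nat, ~~ odd l -> 0 < c l)
    (hc : is_hardy_weight_expansion p c)
    (psi : nat -> R) (hpsi : finitely_supported psi) :
  (\sum_(0 <= l <oo | ~~ odd l)
      ((c l)%:E * \sum_(1 <= n <oo) sup_term p l psi n)
   <= \sum_(1 <= n <oo) (`|psi n| ^+ p)%:E)%E.
Proof.
have p0 : (0 < p)%N by exact: ltnW.
have c0 l : ~~ odd l -> 0 <= c l by move=> /hc_pos/ltW.
have [N psiN] := finitely_supported_bound hpsi.
have [|k Nk|g [g0 g_dec g_sum]] :=
    @nonincreasing_rearrangement _ (fun k => `|psi k.+1|) N.
- by [].
- by rewrite psiN ?normr0.
have psi_g := ler_sum_rearrangement _ g_dec g_sum.
pose Phi n := \sum_(0 <= k < n) g k.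
have Phi0 n : 0 <= Phi n by apply: sumr_ge0.
pose T l n : R := n%:R ^- (l + p) * Phi n ^+ p.
have T0 l n : 0 <= T l n by rewrite mulr_ge0 ?invr_ge0 ?exprn_ge0.
(* The terms are nonnegative, so it suffices to bound partial sums: in [l] here, and in [n] once the
   finite sum over [l] has been moved inside. *)
apply: lime_le.
  apply: is_cvg_nneseries_cond => l _ el; apply: mule_ge0.
    by rewrite lee_fin c0.
  by apply: nneseries_ge0 => n _ _; exact: sup_term_ge0.
apply: nearW => L.
apply: (@le_trans _ _ (\sum_(0 <= l < L | ~~ odd l)
    \sum_(1 <= n <oo) (c l * T l n)%:E)%E).
  apply: lee_sum => l el.
  rewrite -nneseriesZl; last by move=> n _; exact: sup_term_ge0.
  rewrite eseries_cond [leRHS]eseries_cond; apply: lee_nneseries => n /=.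
    by move=> _ _; rewrite mule_ge0 ?sup_term_ge0 ?lee_fin ?c0.
  by move=> n0; rewrite EFinM lee_wpmul2l ?lee_fin ?c0 ?sup_term_le.
rewrite -nneseries_sum; last first.
  by move=> l n el; rewrite lee_fin mulr_ge0 ?c0.
apply: lime_le.
  apply: is_cvg_nneseries => n _ _.
  by apply: sume_ge0 => l el; rewrite lee_fin mulr_ge0 ?c0.
apply: nearW => M.
(* The truncation must reach [N], from where on the sums over [psi] and over [g] agree. *)
apply: (@le_trans _ _ (\sum_(1 <= n < (maxn M N).+1) (`|psi n| ^+ p)%:E)%E); last first.
  by apply: nneseries_lim_ge => n _ _; rewrite lee_fin exprn_ge0.
rewrite big_add1 [leRHS]big_add1 /= [leRHS]sumEFin.
under eq_bigr do rewrite sumEFin.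
rewrite sumEFin lee_fin.
rewrite -(g_sum (fun x => x ^+ p)) ?leq_maxr //.
have MK : (M.-1 <= maxn M N)%N by rewrite (leq_trans (leq_pred M)) ?leq_maxl.
rewrite (big_cat_nat (leq0n _) MK) //= -[leLHS]addr0; apply: lerD; last first.
  by apply: sumr_ge0 => k _; rewrite exprn_ge0.
move: p0 hp; case: p => // q in hc g_sum T T0 * => _ q0.
(* For each [n] the truncated expansion factors out of the sum over [l] and is bounded by the
   weight. *)
apply: le_trans (hardy_partial M.-1 q0 g0).
apply: ler_sum => n _; rewrite -/(Phi n.+1) /T.
under eq_bigr do rewrite mulrA.
by rewrite -mulr_suml ler_wpM2r ?exprn_ge0 ?expansion_partial_le.
Qed.
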